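(* Let $M\ge 2$, $N=2M$, and let $\{\beta_k,B_k,L_k\}_{k=1}^N$ be juncture parameters of Type III-OAE (defined in the context). Then the prismatic juncture with these parameters is flexible.
   Context: Juncture parameters: for an even integer $N\ge 4$, real numbers $L_k>0$ and $\beta_k,B_k\in(0,\pi)$, $k=1,\dots,N$; the index $k$ is cyclic mod $N$. Type III-OAE: there are angles $\beta,B\in(0,\pi)$ and an integer $L$ with $3\le L\le N-2$ if $N\ge 6$, and $L=3$ if $N=4$, such that the following holds. Write $N=2M$. If $L=2k_x$ is even: $\beta_{2k-1}=\beta,\ B_{2k-1}=B$ for $1\le k\le k_x$; $\beta_{2k-1}=\pi-\beta,\ B_{2k-1}=\pi-B$ for $k_x+1\le k\le M$; $\beta_{2k}=\pi-B,\ B_{2k}=\pi-\beta$ for $1\le k\le k_x-1$; $\beta_{2k}=B,\ B_{2k}=\beta$ for $k_x\le k\le M$; and $$\sum_{k=1}^{k_x-1}L_{2k}=\sum_{k=k_x}^{M}L_{2k},\qquad \sum_{k=1}^{k_x}L_{2k-1}=\sum_{k=k_x+1}^{M}L_{2k-1}.$$ If $L=2k_x+1$ is odd: $\beta_{2k-1}=\beta,\ B_{2k-1}=B$ for $1\le k\le k_x$; $\beta_{2k-1}=\pi-\beta,\ B_{2k-1}=\pi-B$ for $k_x+1\le k\le M$; $\beta_{2k}=\pi-B,\ B_{2k}=\pi-\beta$ for $1\le k\le k_x$; $\beta_{2k}=B,\ B_{2k}=\beta$ for $k_x+1\le k\le M$; and $$\sum_{k=1}^{k_x}L_{2k}=\sum_{k=k_x+1}^{M}L_{2k},\qquad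 \sum_{k=1}^{k_x}L_{2k-1}=\sum_{k=k_x+1}^{M}L_{2k-1}.$$ For $\theta\in(0,\pi/2)$ let $\mathbf u(\theta)=(-\sin\theta,-\cos\theta,0)$ and $\mathbf w(\theta)=(\sin\theta,-\cos\theta,0)$, unit vectors at angle $2\theta$. A (prismatic) juncture at $\theta$ with the given parameters is a closed polygon $\mathbf v_1,\dots,\mathbf v_N\in\mathbb R^3$ ($\mathbf v_{N+1}=\mathbf v_1$) with, for every $k=1,\dots,N$, $$|\mathbf v_{k+1}-\mathbf v_k|=L_k,\quad (\mathbf v_{k+1}-\mathbf v_k)\cdot\mathbf u(\theta)=L_k\cos\beta_k,\quad (\mathbf v_{k+1}-\mathbf v_k)\cdot\mathbf w(\theta)=L_k\cos B_k .$$ Geometrically, it carries two unbounded tubes made of the half-strips $\{\mathbf p+s\mathbf u\}$ and $\{\mathbf p+s\mathbf w\}$ ($\mathbf p\in[\mathbf v_k,\mathbf v_{k+1}]$, $s\ge0$); $\beta_k$ and $B_k$ are the face angles at $\mathbf v_k$. Self-intersections are allowed. The juncture with given parameters is flexible if there are an interval $I\subset(0,\pi/2)$ of positive length and continuous maps $\mathbf v_1,\dots,\mathbf v_N:I\to\mathbb R^3$ such that for every $\theta\in I$ the points $\mathbf v_1(\theta),\dots,\mathbf v_N(\theta)$ form a juncture at $\theta$ with these (fixed) parameters. *)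

(* Defs.v *)
From mathcomp Require Import all_boot all_order all_algebra.
From mathcomp Require Import all_classical all_reals all_analysis.

Set Implicit Arguments.
Unset Strict Implicit.
Unset Printing Implicit Defensive.

Import Order.TTheory GRing.Theory Num.Theory.
Import numFieldNormedType.Exports.

Local Open Scope classical_set_scope.
Local Open Scope ring_scope.

(* Sequences indexed by k = 1, ..., N are functions on nat of which only the
   values at 1 <= k <= N matter (for the vertices of a closed polygon, also
   the value at N + 1, which is required to be v_1). *)

(* The norm `|_| on 'rV[R]_3 is the sup norm, hence the Euclidean one here. *)
Definition dot (R : realType) (x y : 'rV[R]_3) : R := \sum_(j < 3) x 0 j * y 0 j.

Definition enorm (R : realType) (x : 'rV[R]_3) : R := Num.sqrt (dot x x).

Definition vec3 (R : realType) (x y z : R) : 'rV[R]_3 :=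
  \row_(j < 3) [:: x; y; z]`_j.

Definition dir_u (R : realType) (t : R) : 'rV[R]_3 :=
  vec3 (- sin t) (- cos t) 0.

Definition dir_w (R : realType) (t : R) : 'rV[R]_3 :=
  vec3 (sin t) (- cos t) 0.

Definition juncture_parameters (R : realType) (N : nat)
    (len beta B : nat -> R) : Prop :=
  [/\ ~~ odd N, (4 <= N)%N &
      forall k : nat, (1 <= k <= N)%N ->
        [/\ 0 < len k, 0 < beta k < pi & 0 < B k < pi]].

Definition is_juncture (R : realType) (N : nat) (len beta B : nat -> R)
    (t : R) (v : nat -> 'rV[R]_3) : Prop :=
  v N.+1 = v 1%N /\
  forall k : nat, (1 <= k <= N)%N ->
    [/\ enorm (v k.+1 - v k) = len k,
        dot (v k.+1 - v k) (dir_u t) = len k * cos (beta k) &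
        dot (v k.+1 - v k) (dir_w t) = len k * cos (B k)].

Definition flexible (R : realType) (N : nat) (len beta B : nat -> R) : Prop :=
  exists (I : interval R) (v : nat -> R -> 'rV[R]_3),
    [/\ [set` I] `<=` [set t | 0 < t < pi / 2],
        (exists a b : R, [/\ a \in I, b \in I & a < b]),
        (forall k : nat, (1 <= k <= N)%N -> {within [set` I], continuous (v k)}) &
        forall t : R, t \in I -> is_juncture N len beta B t (fun k => v k t)].

(* N = 2M, l = 2kx; the fixed angles are b and c. *)
Definition OAE_even (R : realType) (M kx : nat) (b c : R)
    (len beta B : nat -> R) : Prop :=
  [/\ (forall k : nat, (1 <= k <= kx)%N ->
         beta (2 * k - 1)%N = b /\ B (2 * k - 1)%N = c),
      (forall k : nat, (kx + 1 <= k <= M)%N ->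
         beta (2 * k - 1)%N = pi - b /\ B (2 * k - 1)%N = pi - c),
      (forall k : nat, (1 <= k <= kx - 1)%N ->
         beta (2 * k)%N = pi - c /\ B (2 * k)%N = pi - b),
      (forall k : nat, (kx <= k <= M)%N ->
         beta (2 * k)%N = c /\ B (2 * k)%N = b) &
      \sum_(1 <= k < kx) len (2 * k)%N = \sum_(kx <= k < M.+1) len (2 * k)%N /\
      \sum_(1 <= k < kx.+1) len (2 * k - 1)%N =
        \sum_(kx.+1 <= k < M.+1) len (2 * k - 1)%N].

(* N = 2M, l = 2kx + 1. *)
Definition OAE_odd (R : realType) (M kx : nat) (b c : R)
    (len beta B : nat -> R) : Prop :=
  [/\ (forall k : nat, (1 <= k <= kx)%N ->
         beta (2 * k - 1)%N = b /\ B (2 * k - 1)%N = c),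
      (forall k : nat, (kx + 1 <= k <= M)%N ->
         beta (2 * k - 1)%N = pi - b /\ B (2 * k - 1)%N = pi - c),
      (forall k : nat, (1 <= k <= kx)%N ->
         beta (2 * k)%N = pi - c /\ B (2 * k)%N = pi - b),
      (forall k : nat, (kx + 1 <= k <= M)%N ->
         beta (2 * k)%N = c /\ B (2 * k)%N = b) &
      \sum_(1 <= k < kx.+1) len (2 * k)%N =
        \sum_(kx.+1 <= k < M.+1) len (2 * k)%N /\
      \sum_(1 <= k < kx.+1) len (2 * k - 1)%N =
        \sum_(kx.+1 <= k < M.+1) len (2 * k - 1)%N].

Definition type_III_OAE (R : realType) (M : nat) (len beta B : nat -> R) : Prop :=
  exists (b c : R) (l : nat),
    [/\ 0 < b < pi, 0 < c < pi,
        ((6 <= 2 * M)%N -> (3 <= l <= 2 * M - 2)%N) /\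
        ((2 * M)%N = 4%N -> l = 3%N) &
        (exists2 kx : nat, l = (2 * kx)%N & OAE_even M kx b c len beta B) \/
        (exists2 kx : nat, l = (2 * kx + 1)%N & OAE_odd M kx b c len beta B)].

(* Main.v *)
Require Import Defs.
From mathcomp Require Import all_boot all_order all_algebra.
From mathcomp Require Import all_classical all_reals all_analysis.
From mathcomp Require Import ring lra zify.

Set Implicit Arguments.
Unset Strict Implicit.
Unset Printing Implicit Defensive.

Import Order.TTheory GRing.Theory Num.Theory.
Import numFieldNormedType.Exports.

Local Open Scope classical_set_scope.
Local Open Scope ring_scope.

(** The edge directions compatible with the prescribed angles are determined up
to the sign of the third coordinate: with x = cos b, y = cos c, and
X = (y - x) / (2 sin t), Y = (x + y) / (2 cos t), Z = sqrt (1 - X^2 - Y^2), one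
can take +-(X, -Y, Z) for odd edges and +-(X, Y, Z) for even ones, the sign
being + exactly on the first block of the indices of each parity. The polygon
then closes up because of the two length conditions, for every t with
X^2 + Y^2 < 1. Such t form an open set, which is nonempty because the minimum of
X^2 + Y^2 over t is max(|x|, |y|)^2 < 1. *)

(** * Dot product, Euclidean norm and continuity in coordinates *)

Lemma dot_vec3 (R : realType) (x y z x' y' z' : R) :
  dot (vec3 x y z) (vec3 x' y' z') = x * x' + y * y' + z * z'.
Proof. by rewrite /dot !big_ord_recr big_ord0 /= !mxE /= add0r. Qed.

Lemma dotZl (R : realType) (a : R) (x y : 'rV[R]_3) :
  dot (a *: x) y = a * dot x y.
Proof. by rewrite /dot mulr_sumr; apply: eq_bigr => j _; rewrite !mxE mulrA. Qed.

Lemma enormZ (R : realType) (a : R) (x : 'rV[R]_3) :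
  enorm (a *: x) = `|a| * enorm x.
Proof.
have -> : enorm (a *: x) = Num.sqrt (a ^+ 2 * dot x x).
  congr Num.sqrt; rewrite dotZl /dot !mulr_sumr; apply: eq_bigr => j _.
  by rewrite !mxE; ring.
by rewrite sqrtrM ?sqr_ge0// sqrtr_sqr.
Qed.

Lemma continuous_vec3 (R : realType) (f g h : R -> R) (t : R) :
  {for t, continuous f} -> {for t, continuous g} -> {for t, continuous h} ->
  {for t, continuous (fun s => vec3 (f s) (g s) (h s))}.
Proof.
move=> cf cg ch.
(* In the standard basis, continuity reduces to that of scalar multiples of fixed vectors and of
   their sum. *)
have -> : (fun s => vec3 (f s) (g s) (h s)) =
   (fun s => f s *: vec3 1 0 0 + g s *: vec3 0 1 0 + h s *: vec3 0 0 1).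
  apply/funext => s; apply/rowP => j; rewrite !mxE.
  by case: j => [[|[|[|//]]] ?] /=; ring.
by apply: cvgD; [apply: cvgD|]; apply: cvgZr_tmp.
Qed.

(** * Edge directions and the range of admissible [t] *)

Section EdgeDirection.
Variables (R : realType) (x y : R).

Definition edge_x (t : R) : R := (y - x) / (2 * sin t).
Definition edge_y (t : R) : R := (x + y) / (2 * cos t).
Definition edge_z_sqr (t : R) : R := 1 - edge_x t ^+ 2 - edge_y t ^+ 2.
(** The sign [r] is -1 for odd edges and 1 for even ones. The square root makes this total in [t];
    it is a unit vector only where [edge_z_sqr t] is nonnegative. *)
Definition edge_dir (r t : R) : 'rV[R]_3 :=
  vec3 (edge_x t) (r * edge_y t) (Num.sqrt (edge_z_sqr t)).

Lemma continuous_edge_x (t : R) : sin t != 0 -> {for t, continuous edge_x}.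
Proof.
move=> s0; apply: cvgM; first exact: cvg_cst.
apply: cvgV; first by rewrite mulf_neq0.
by apply: cvgM; [exact: cvg_cst|exact: continuous_sin].
Qed.

Lemma continuous_edge_y (t : R) : cos t != 0 -> {for t, continuous edge_y}.
Proof.
move=> s0; apply: cvgM; first exact: cvg_cst.
apply: cvgV; first by rewrite mulf_neq0.
by apply: cvgM; [exact: cvg_cst|exact: continuous_cos].
Qed.

Lemma continuous_edge_z_sqr (t : R) : sin t != 0 -> cos t != 0 ->
  {for t, continuous edge_z_sqr}.
Proof.
move=> /continuous_edge_x cx /continuous_edge_y cy.
apply: cvgB; first (apply: cvgB; first exact: cvg_cst).
- by rewrite expr2; under eq_fun do rewrite expr2; exact: cvgM.
- by rewrite expr2; under eq_fun do rewrite expr2; exact: cvgM.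
Qed.

Lemma continuous_edge_dir (r t : R) : sin t != 0 -> cos t != 0 ->
  {for t, continuous (edge_dir r)}.
Proof.
move=> s0 c0; apply: continuous_vec3.
- exact: continuous_edge_x.
- by apply: cvgM; [exact: cvg_cst|exact: continuous_edge_y].
- apply: (@continuous_comp _ _ _ edge_z_sqr Num.sqrt).
    exact: continuous_edge_z_sqr.
  exact: sqrt_continuous.
Qed.

Lemma enorm_edge_dir (r t : R) : r ^+ 2 = 1 -> 0 <= edge_z_sqr t ->
  enorm (edge_dir r t) = 1.
Proof.
move=> r1 z0; rewrite /enorm dot_vec3 -(expr2 (Num.sqrt _)) sqr_sqrtr//.
rewrite [X in Num.sqrt X](_ : _ = 1) ?sqrtr1// /edge_z_sqr.
have -> : r * edge_y t * (r * edge_y t) = r ^+ 2 * edge_y t ^+ 2 by ring.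
by rewrite r1; ring.
Qed.

(** The value is [x] for [r = -1] and [- y] for [r = 1]; against [dir_w] the values are [y] and
    [- x]. This is the swap of the two angles between odd and even edges. *)
Lemma dot_edge_dir_u (r t : R) : sin t != 0 -> cos t != 0 ->
  dot (edge_dir r t) (dir_u t) = (x - y) / 2 - r * ((x + y) / 2).
Proof.
by move=> s0 c0; rewrite dot_vec3 /edge_x /edge_y; field; apply/andP.
Qed.

Lemma dot_edge_dir_w (r t : R) : sin t != 0 -> cos t != 0 ->
  dot (edge_dir r t) (dir_w t) = (y - x) / 2 - r * ((x + y) / 2).
Proof.
by move=> s0 c0; rewrite dot_vec3 /edge_x /edge_y; field; apply/andP.
Qed.

(* sin^2 t = |a| + e and cos^2 t = |d| + e, where a = (y - x) / 2, d = (x + y) / 2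
   and 1 - |a| - |d| = 2 e; here |a| + |d| = max(|x|, |y|). *)
Lemma exists_edge_z_sqr_gt0 : `|x| < 1 -> `|y| < 1 ->
  exists2 t : R, 0 < t < pi / 2 & 0 < edge_z_sqr t.
Proof.
rewrite !ltr_norml => /andP[x1 x2] /andP[y1 y2].
pose a := `|(y - x) / 2|; pose d := `|(x + y) / 2|.
have ad : a + d < 1.
  rewrite /a /d; case: (ger0P ((y - x) / 2)) => _.
    by case: (ger0P ((x + y) / 2)) => _; lra.
  by case: (ger0P ((x + y) / 2)) => _; lra.
have a0 : 0 <= a := normr_ge0 _.
have d0 : 0 <= d := normr_ge0 _.
have a2 : a ^+ 2 = ((y - x) / 2) ^+ 2 by rewrite real_normK ?num_real.
have d2 : d ^+ 2 = ((x + y) / 2) ^+ 2 by rewrite real_normK ?num_real.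
pose e := (1 - a - d) / 2.
have e0 : 0 < e by rewrite /e; lra.
pose s := Num.sqrt (a + e).
have s2 : s ^+ 2 = a + e by rewrite sqr_sqrtr//; lra.
have s0 : 0 < s by rewrite sqrtr_gt0; lra.
have s1 : s < 1 by rewrite -(@ltr_pXn2r _ 2) ?nnegrE ?(ltW s0)// expr1n s2 /e; lra.
exists (asin s).
  rewrite asin_ltpi2 ?andbT; last lra.
  rewrite ltNge; apply/negP => as0.
  have : sin (asin s) <= 0.
    rewrite -oppr_ge0 -sinN sin_ge0_pi// oppr_ge0 as0/=.
    have := @asin_geNpi2 _ s; have := @pi_gt0 R; lra.
  by rewrite asinK ?in_itv/=; lra.
rewrite /edge_z_sqr /edge_x /edge_y asinK ?in_itv/=; last lra.
rewrite cos_asin; last lra.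
have -> : 1 - s ^+ 2 = d + e by rewrite s2 /e; field.
have -> : ((y - x) / (2 * s)) ^+ 2 = a ^+ 2 / (a + e).
  by rewrite -s2 a2; field; rewrite gt_eqF.
have r0 : 0 < Num.sqrt (d + e) by rewrite sqrtr_gt0; lra.
have -> : ((x + y) / (2 * Num.sqrt (d + e))) ^+ 2 = d ^+ 2 / (d + e).
  rewrite -[in RHS](@sqr_sqrtr _ (d + e)); last lra.
  by rewrite d2; field; rewrite gt_eqF.
(* The slack [e > 0] keeps the denominators positive, even if [a] or [d] vanishes, and bounds the
   sum of both squares by [a + d < 1]. *)
have ha : a ^+ 2 / (a + e) <= a by rewrite ler_pdivrMr; nra.
have hd : d ^+ 2 / (d + e) <= d by rewrite ler_pdivrMr; nra.
lra.
Qed.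

Lemma exists_interval_edge_z_sqr_gt0 : `|x| < 1 -> `|y| < 1 ->
  exists (t e : R), 0 < e /\
    forall s, s \in `]t - e, t + e[ -> 0 < s < pi / 2 /\ 0 < edge_z_sqr s.
Proof.
move=> x1 y1; have [t t0 zt] := exists_edge_z_sqr_gt0 x1 y1.
have sc0 : sin t != 0 /\ cos t != 0.
  rewrite !gt_eqF// ?sin_gt0_pihalf ?cos_gt0_pihalf//.
  by have := @pi_gt0 R; lra.
have : \forall s \near t, 0 < s < pi / 2 /\ 0 < edge_z_sqr s.
  near=> s; split.
    apply/andP; split; near: s.
      by apply: lt_nbhsr; lra.
    by apply: lt_nbhsl; lra.
  near: s; exact: (continuous_edge_z_sqr sc0.1 sc0.2 (lt_nbhsr zt)).
move=> /nbhs_ballP[e /= e0 he]; exists t, e; split => // s.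
rewrite in_itv/= => s_in; apply: he.
by rewrite /ball/= ltr_distlC; lra.
Unshelve. all: by end_near.
Qed.

End EdgeDirection.

(** * Alternating sums and closing of the polygon *)

Lemma sum_odd_even (V : zmodType) (F : nat -> V) (n : nat) :
  \sum_(1 <= i < (2 * n).+1) F i =
  \sum_(1 <= k < n.+1) F (2 * k - 1)%N + \sum_(1 <= k < n.+1) F (2 * k)%N.
Proof.
elim: n => [|n IHn]; first by rewrite !big_geq ?addr0.
rewrite (@big_nat_recr _ _ _ n.+1)//= (@big_nat_recr _ _ _ n.+1)//=.
have -> : (2 * n.+1 = (2 * n).+2)%N by lia.
have -> : ((2 * n).+2 - 1 = (2 * n).+1)%N by lia.
rewrite (@big_nat_recr _ _ _ (2 * n).+2)//= (@big_nat_recr _ _ _ (2 * n).+1)//=.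
by rewrite IHn -!addrA; congr (_ + _); rewrite addrCA.
Qed.

(** Edges of equal parity are parallel, with orientation [sg k], so the polygon closes as soon as
    the signed lengths of each parity cancel. *)
Lemma flexible_of_signs (R : realType) (M : nat) (len beta B sg : nat -> R)
    (x y : R) :
  `|x| < 1 -> `|y| < 1 ->
  (forall k, `|sg k| = 1) -> (forall k, (1 <= k <= 2 * M)%N -> 0 < len k) ->
  (forall k, (1 <= k <= M)%N ->
     cos (beta (2 * k - 1)%N) = sg (2 * k - 1)%N * x /\
     cos (B (2 * k - 1)%N) = sg (2 * k - 1)%N * y) ->
  (forall k, (1 <= k <= M)%N ->
     cos (beta (2 * k)%N) = - (sg (2 * k)%N * y) /\
     cos (B (2 * k)%N) = - (sg (2 * k)%N * x)) ->
  \sum_(1 <= k < M.+1) sg (2 * k - 1)%N * len (2 * k - 1)%N = 0 ->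
  \sum_(1 <= k < M.+1) sg (2 * k)%N * len (2 * k)%N = 0 ->
  flexible (2 * M) len beta B.
Proof.
move=> x1 y1 sg1 len0 odd_cos even_cos odd_sum even_sum.
have [t0 [e [e0 tP]]] := exists_interval_edge_z_sqr_gt0 x1 y1.
have sc0 t : t \in `]t0 - e, t0 + e[ -> sin t != 0 /\ cos t != 0.
  move=> /tP[t_in _]; rewrite !gt_eqF// ?sin_gt0_pihalf ?cos_gt0_pihalf//.
  by have := @pi_gt0 R; lra.
pose r k : R := if odd k then -1 else 1.
pose edge k t := (sg k * len k) *: edge_dir x y (r k) t.
(* The vertices are partial sums of the edges, starting from the empty sum [v_1 = 0]. *)
exists `]t0 - e, t0 + e[, (fun k t => \sum_(1 <= i < k) edge i t); split.
- by move=> t /tP[].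
- by exists t0, (t0 + e / 2); rewrite !in_itv/=; split; lra.
- move=> k _; apply: continuous_in_subspaceT => t.
  rewrite inE => /sc0[s0 c0].
  apply: cvg_big => [|i _]; first exact: add_continuous.
  by apply: cvgZl_tmp; exact: continuous_edge_dir.
- move=> t t_in; have [s0 c0] := sc0 _ t_in; have [_ z0] := tP _ t_in.
  split.
    rewrite [RHS]big_geq// sum_odd_even.
    rewrite [X in X + _](_ : _ = 0) ?add0r.
      rewrite (eq_bigr (fun k => (sg (2 * k)%N * len (2 * k)%N) *: edge_dir x y 1 t)).
        by rewrite -scaler_suml even_sum scale0r.
      by move=> k _; rewrite /edge /r oddM.
    rewrite big_nat (eq_bigr (fun k =>
      (sg (2 * k - 1)%N * len (2 * k - 1)%N) *: edge_dir x y (-1) t)).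
      by rewrite -big_nat -scaler_suml odd_sum scale0r.
    by move=> k k1; rewrite /edge /r (_ : odd _)//; lia.
  move=> k k_in; have lk := len0 _ k_in.
  have -> : \sum_(1 <= i < k.+1) edge i t - \sum_(1 <= i < k) edge i t = edge k t.
    by case/andP: k_in => k_gt0 _; rewrite big_nat_recr//= addrAC subrr add0r.
  have r1 : r k ^+ 2 = 1 by rewrite /r; case: ifP => _; ring.
  rewrite !dotZl dot_edge_dir_u// dot_edge_dir_w// enormZ enorm_edge_dir ?(ltW z0)//.
  rewrite mulr1 normrM sg1 mul1r gtr0_norm//.
  (* The parity fixes [r], and the two dot products become the prescribed cosines up to the sign
     [sg k]. *)
  rewrite /r; case: ifPn => k_odd.
  + have [j j_in ->] : exists2 j, (1 <= j <= M)%N & k = (2 * j - 1)%N.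
      by exists (k.+1./2); lia.
    by have [-> ->] := odd_cos _ j_in; split => //; field.
  + have [j j_in ->] : exists2 j, (1 <= j <= M)%N & k = (2 * j)%N.
      by exists (k./2); lia.
    by have [-> ->] := even_cos _ j_in; split => //; field.
Qed.

(** The boolean exponent gives sign 1 up to [m] and -1 beyond, so two blocks of equal sum cancel. *)
Lemma sum_block_signs (R : pzRingType) (F : nat -> R) (m n : nat) : (m <= n)%N ->
  \sum_(1 <= k < m.+1) F k = \sum_(m.+1 <= k < n.+1) F k ->
  \sum_(1 <= k < n.+1) (-1) ^+ (m < k)%N * F k = 0.
Proof.
move=> mn Fmn; rewrite (big_cat_nat (n := m.+1))//=.
have -> : \sum_(1 <= k < m.+1) (-1) ^+ (m < k)%N * F k = \sum_(1 <= k < m.+1) F k.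
  by apply: eq_big_nat => k /andP[_ km]; rewrite ltnNge -ltnS km mul1r.
rewrite Fmn -big_split big_nat_cond big1//= => k /andP[/andP[-> _] _].
by rewrite expr1 mulN1r subrr.
Qed.

(** * Sign patterns of Type III-OAE *)

Lemma cos_piB (R : realType) (x : R) : cos (pi - x) = - cos x.
Proof. by rewrite cosB cospi sinpi mul0r addr0 mulN1r. Qed.

Lemma normr_cos_lt1 (R : realType) (x : R) : 0 < x < pi -> `|cos x| < 1.
Proof.
move=> /sin_gt0_pi s0; have := cos2Dsin2 x.
have : 0 < sin x ^+ 2 by rewrite exprn_gt0.
by rewrite ltr_norml; nra.
Qed.

(** Common form of the even and odd cases: [m] and [n] are the sizes of the first blocks of odd and
    even indices. Passing to supplementary angles in the second block negates both cosines, hence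
    the sign. *)
Lemma flexible_of_blocks (R : realType) (M m n : nat) (b c : R)
    (len beta B : nat -> R) :
  (m <= M)%N -> (n <= M)%N ->
  juncture_parameters (2 * M) len beta B -> 0 < b < pi -> 0 < c < pi ->
  (forall k, (1 <= k <= m)%N ->
     beta (2 * k - 1)%N = b /\ B (2 * k - 1)%N = c) ->
  (forall k, (m < k <= M)%N ->
     beta (2 * k - 1)%N = pi - b /\ B (2 * k - 1)%N = pi - c) ->
  (forall k, (1 <= k <= n)%N ->
     beta (2 * k)%N = pi - c /\ B (2 * k)%N = pi - b) ->
  (forall k, (n < k <= M)%N ->
     beta (2 * k)%N = c /\ B (2 * k)%N = b) ->
  \sum_(1 <= k < n.+1) len (2 * k)%N = \sum_(n.+1 <= k < M.+1) len (2 * k)%N ->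
  \sum_(1 <= k < m.+1) len (2 * k - 1)%N =
    \sum_(m.+1 <= k < M.+1) len (2 * k - 1)%N ->
  flexible (2 * M) len beta B.
Proof.
move=> mM nM [_ _ par] b_in c_in odd1 odd2 even1 even2 even_len odd_len.
(* [uphalf] recovers [k] from [2k - 1], and halving recovers it from [2k]. *)
pose sg i : R := (-1) ^+ (if odd i then (m < uphalf i)%N else (n < i./2)%N).
have sg_odd k : (0 < k)%N -> sg (2 * k - 1)%N = (-1) ^+ (m < k)%N.
  move=> k0; rewrite /sg (_ : odd _); last lia.
  by rewrite (_ : uphalf _ = k)//; lia.
have sg_even k : sg (2 * k)%N = (-1) ^+ (n < k)%N.
  by rewrite /sg oddM/= mul2n doubleK.
apply: (@flexible_of_signs _ _ _ _ _ sg (cos b) (cos c)).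
- exact: normr_cos_lt1.
- exact: normr_cos_lt1.
- by move=> k; rewrite normrX normrN1 expr1n.
- by move=> k /par[].
- move=> k k_in; rewrite sg_odd; last lia.
  case: ltnP => mk.
    have [|-> ->] := odd2 k; first lia.
    by rewrite !cos_piB !expr1 !mulN1r.
  have [|-> ->] := odd1 k; first lia.
  by rewrite !expr0 !mul1r.
- move=> k k_in; rewrite sg_even.
  case: ltnP => nk.
    have [|-> ->] := even2 k; first lia.
    by rewrite !expr1 !mulN1r !opprK.
  have [|-> ->] := even1 k; first lia.
  by rewrite !cos_piB !expr0 !mul1r.
- rewrite -[RHS](sum_block_signs mM odd_len) big_nat [RHS]big_nat.
  by apply: eq_bigr => k /andP[k0 _]; rewrite sg_odd.
- rewrite -[RHS](sum_block_signs nM even_len).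
  by apply: eq_bigr => k _; rewrite sg_even.
Qed.

Theorem mainTheorem4 (R : realType) (M : nat) (len beta B : nat -> R) :
  (2 <= M)%N ->
  juncture_parameters (2 * M) len beta B ->
  type_III_OAE M len beta B ->
  flexible (2 * M) len beta B.
Proof.
move=> M2 par [b [c [l [b_in c_in [l6 l4] blocks]]]].
(* Since [l] is [2 * kx] or [2 * kx + 1], this gives [0 < kx] and [kx <= M]. *)
have l_in : (3 <= l < 2 * M)%N.
  case: (ltnP 2 M) => M3; first by have := l6 ltac:(lia); lia.
  by have := l4 ltac:(lia); lia.
case: blocks => [] [kx lE [odd1 odd2 even1 even2 [even_len odd_len]]].
(* For even [l], the second block of even indices already starts at [k = kx], so the first one has
   size [kx - 1]. *)
- apply: (@flexible_of_blocks _ M kx kx.-1 b c) => //; try lia.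
  + by move=> k k_in; apply: odd2; lia.
  + by move=> k k_in; apply: even1; lia.
  + by move=> k k_in; apply: even2; lia.
  + by rewrite prednK//; lia.
- apply: (@flexible_of_blocks _ M kx kx b c) => //; try lia.
  + by move=> k k_in; apply: odd2; lia.
  + by move=> k k_in; apply: even2; lia.
Qed.
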